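(* Let $\alpha\neq 0$ be real. For any $\delta\in[0,\infty]$, the $s$-dimensional Hausdorff measure of $\Theta_{\delta}(\alpha)$ is $0$ for all $s\geq\frac{1}{1+\delta}$. In particular: (1) the Hausdorff dimension of $\Theta_{\delta}(\alpha)$ is at most $\frac{1}{1+\delta}$; (2) for any fixed $\alpha\neq 0$ the set of $\zeta>1$ with $\overline{\sigma}(\alpha,\zeta)>0$ has Lebesgue measure $0$.
   Context: For real $x$, $\Vert x\Vert$ denotes the distance from $x$ to the nearest integer. For real $\alpha\neq 0$ and $\zeta>1$, $$\overline{\sigma}(\alpha,\zeta):=\limsup_{n\to\infty}-\frac{\log\Vert\alpha\zeta^{n}\Vert}{n\log\zeta},$$ where $n$ runs through the positive integers and the quotient is read as $+\infty$ when $\Vert\alpha\zeta^n\Vert=0$. For real $\alpha\neq 0$ and real $\delta\geq 0$, $\Theta_\delta(\alpha)$ denotes the set of real $\zeta>1$ such that $\overline{\sigma}(\alpha,\zeta)>\delta$; and $\Theta_\infty(\alpha)$ denotes the set of real $\zeta>1$ such that $\overline{\sigma}(\alpha,\zeta)=\infty$. For $\delta=\infty$, $\frac{1}{1+\delta}$ is read as $0$.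
   Formalization: The measure claim is stated for s > 0 only, which excludes just δ = ∞, s = 0; there the claim is false, since the 0-dimensional measure is counting measure and, for example, ζ = 2 lies in Θ_∞(1). *)

(* Defs.v *)
From mathcomp Require Export all_boot all_order all_algebra.
From mathcomp Require Export all_classical all_reals all_analysis.
Set Implicit Arguments.
Unset Strict Implicit.
Unset Printing Implicit Defensive.
Import Order.TTheory GRing.Theory Num.Theory.
Import numFieldNormedType.Exports.

Local Open Scope classical_set_scope.
Local Open Scope ring_scope.
Local Open Scope ereal_scope.

Section hausdorff.
Context {R : realType}.
Implicit Types (U A : set R) (s d : R).

(* ediam set0 = -oo, so the empty set satisfies every diameter bound. *)
Definition ediam U : \bar R :=
  ereal_sup [set `|p.1 - p.2|%:E | p in U `*` U].

(* |U|^s, where the empty set contributes 0 even for s = 0 and, since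
   0 `^ 0 = 1, a singleton contributes 1 for s = 0: the 0-dimensional measure
   is the counting measure. *)
Definition ediam_pow s U : \bar R :=
  if U == set0 then 0 else poweR (ediam U) s.

Definition hausdorff_premeasure s d A : \bar R :=
  ereal_inf [set \sum_(0 <= k <oo) ediam_pow s (U k) | U in
    [set U : (set R)^nat |
      A `<=` \bigcup_k U k /\ forall k, ediam (U k) <= d%:E]].

(* The premeasure is nonincreasing in d, so its limit as d -> 0+ is the
   supremum over d > 0. *)
Definition hausdorff_measure s A : \bar R :=
  ereal_sup [set hausdorff_premeasure s d A | d in [set d | (0 < d)%R]].

Definition hausdorff_dim A : \bar R :=
  ereal_inf [set s%:E | s in [set s | (0 <= s)%R /\ hausdorff_measure s A = 0]].

End hausdorff.

Section approximation.
Context {R : realType}.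
Implicit Types (x alpha zeta : R) (n : nat) (delta : \bar R).

Definition dist_int x : R := inf [set `|x - m%:~R|%R | m in [set: int]].

Definition sigma_quotient alpha zeta n : \bar R :=
  if dist_int (alpha * zeta ^+ n) == 0%R then +oo
  else (- ln (dist_int (alpha * zeta ^+ n)) / (n%:R * ln zeta))%:E.

(* The shift makes the exponent run through the positive integers. *)
Definition sigma_sup alpha zeta : \bar R :=
  limn_esup (fun n => sigma_quotient alpha zeta n.+1).

Definition Theta delta alpha : set R :=
  [set zeta | (1 < zeta)%R /\
    if delta == +oo then sigma_sup alpha zeta = +oo
    else delta < sigma_sup alpha zeta].

End approximation.

(* Main.v *)
Require Import Defs.
From HB Require Import structures.
From mathcomp Require Import zify.
From mathcomp Require Import ring lra.
Import Order.TTheory GRing.Theory Num.Theory.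
Import numFieldNormedType.Exports.

(** The argument is a Borel-Cantelli covering argument, localized in the base
    zeta.

    Suppose [sigma_sup alpha zeta] exceeds a real delta > 0.  Then, for
    infinitely many n, alpha zeta^n lies within zeta^(- delta n) of an integer.
    Confine zeta to a window [a, b] and replace zeta^(- delta) by a rate c.  For
    a given n only O(b^n) integers m can be approached.  The points zeta of the
    window with |alpha zeta^n - m| < c^n form a set of diameter O((c / a)^n),
    because the map zeta |-> alpha zeta^n expands distances by a factor of order
    at least a^n there ([close_powers_diam]).  So the exceptional set at stage n
    is covered at cost O((b (c / a)^s)^n) in dimension s
    ([close_powers_premeasure]).  If b (c / a)^s < 1 these costs are summable
    and the points that are exceptional infinitely often form an H^s-null set
    ([hausdorff_measure_limsup_eq0], [hausdorff_measure_close_powers_io]).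

    When a and b are close to zeta and c is close to zeta^(- delta), the ratio
    b (c / a)^s is close to zeta^(1 - s (1 + delta)), which is less than 1 as
    soon as s (1 + delta) > 1.  Rational a, b, c suffice ([rational_window]), so
    countably many null sets cover the whole set
    ([hausdorff_measure_sigma_sup]).  The threshold s = 1 / (1 + delta) is
    itself reached because the inequality delta < [sigma_sup alpha zeta] is
    strict: there is room for a slightly larger delta, depending on zeta.  An
    infinite exponent leaves room for any delta, whence every s > 0.

    The dimension bound follows by taking s just above 1 / (1 + delta), and the
    Lebesgue statement is the case delta = 0, s = 1, because an H^1-null set is
    Lebesgue-null ([hausdorff1_lebesgue_eq0]). *)

Local Open Scope classical_set_scope.
Local Open Scope ring_scope.
Local Open Scope ereal_scope.

Set Implicit Arguments.
Unset Strict Implicit.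
Unset Printing Implicit Defensive.

(** * Hausdorff premeasures as outer measures *)

Section hausdorff_null.
Context {R : realType}.
Implicit Types (s d r : R) (U A : set R).

(** The reals with every set measurable.  [mu_ext] only admits coverings by
    measurable sets, whereas a Hausdorff premeasure admits arbitrary ones;
    with the Borel structure carried by [R], the two families would differ. *)
Definition all_measurable : Type := R.

HB.instance Definition _ := Pointed.on all_measurable.
HB.instance Definition _ := @isMeasurable.Build default_measure_display
  all_measurable discrete_measurable discrete_measurable0
  (@discrete_measurableC _) (@discrete_measurableU _).

Lemma ediam_ge0 U : U !=set0 -> 0 <= ediam U.
Proof.
move=> [x Ux]; apply: ereal_sup_ubound; exists (x, x) => //=.
by rewrite subrr normr0.
Qed.

Lemma ediam_le U r :
  (forall x y, U x -> U y -> (`|x - y| <= r)%R) -> ediam U <= r%:E.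
Proof.
move=> Ur; apply: ge_ereal_sup => _ [[x y] [/= Ux Uy] <-].
by rewrite lee_fin Ur.
Qed.

Lemma ediam_pow0 s : ediam_pow s set0 = 0.
Proof. by rewrite /ediam_pow eqxx. Qed.

Lemma ediam_pow_ge0 s U : 0 <= ediam_pow s U.
Proof. by rewrite /ediam_pow; case: ifP => // _; exact: poweR_ge0. Qed.

Lemma ediam_pow_le s U r : (0 <= s)%R ->
  (forall x y, U x -> U y -> (`|x - y| <= r)%R) -> ediam_pow s U <= (r `^ s)%:E.
Proof.
move=> s0 /ediam_le Ur; rewrite /ediam_pow; case: ifPn => [_|/set0P U0].
  by rewrite lee_fin powR_ge0.
have U_ge0 := ediam_ge0 U0.
rewrite -poweR_EFin; apply: gt0_ler_poweR => //;
  rewrite in_itv/= ?leey ?andbT//.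
exact: le_trans Ur.
Qed.

(** Weighting by +oo every set of diameter larger than [d] turns the
    restriction on the coverings into a property of the weight. *)
Definition small_ediam_pow s d (U : set all_measurable) : \bar R :=
  if ediam U <= d%:E then ediam_pow s U else +oo.

(** A covering that uses a set of diameter larger than [d] has infinite total
    weight, so it does not lower the infimum.  Through this identification the
    premeasure inherits countable subadditivity from the general construction
    of outer measures. *)
Lemma hausdorff_premeasureE s d :
  hausdorff_premeasure s d = mu_ext (small_ediam_pow s d).
Proof.
apply/funext => A; apply/eqP; rewrite eq_le; apply/andP; split.
  apply: le_ereal_inf_tmp => _ [U [_ AU] <-].
  have [Ud|/existsNP[k Uk]] := pselect (forall k, ediam (U k) <= d%:E).
    apply: ereal_inf_lbound; exists U => //.
    by apply: eq_eseriesr => k _; rewrite /small_ediam_pow Ud.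
  rewrite (eseries_pinfty _ _ (k := k))// ?leey//.
  - by move=> n _; rewrite /small_ediam_pow; case: ifP => // _;
      rewrite -ltNye (lt_le_trans _ (ediam_pow_ge0 _ _)).
  - by rewrite /small_ediam_pow; move/negP/negbTE: Uk => ->.
apply: le_ereal_inf_tmp => _ [U [AU Ud] <-].
apply: ereal_inf_lbound; exists U => //.
by apply: eq_eseriesr => k _; rewrite /small_ediam_pow Ud.
Qed.

Lemma small_ediam_pow_ge0 s d (U : set all_measurable) :
  0 <= small_ediam_pow s d U.
Proof.
by rewrite /small_ediam_pow; case: ifP => // _; exact: ediam_pow_ge0.
Qed.

Lemma small_ediam_pow0 s d :
  small_ediam_pow s d (set0 : set all_measurable) = 0.
Proof.
rewrite /small_ediam_pow ediam_pow0; case: ifPn => //.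
by rewrite /ediam setX0 image_set0 ereal_sup0 leNye.
Qed.

Lemma hausdorff_premeasure0 s d : hausdorff_premeasure s d set0 = 0.
Proof.
rewrite hausdorff_premeasureE mu_ext0//; first exact: small_ediam_pow0.
exact: small_ediam_pow_ge0.
Qed.

Lemma hausdorff_premeasure_ge0 s d A : 0 <= hausdorff_premeasure s d A.
Proof.
by rewrite hausdorff_premeasureE mu_ext_ge0//; exact: small_ediam_pow_ge0.
Qed.

Lemma le_hausdorff_premeasure s d :
  {homo hausdorff_premeasure s d : A B / A `<=` B >-> A <= B}.
Proof. by move=> A B AB; rewrite hausdorff_premeasureE; exact: le_mu_ext. Qed.

Lemma hausdorff_premeasure_sigma_subadditive s d :
  sigma_subadditive (hausdorff_premeasure s d).
Proof.
rewrite hausdorff_premeasureE.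
exact: (mu_ext_sigma_subadditive (small_ediam_pow_ge0 s d)).
Qed.

HB.instance Definition _ s d := isOuterMeasure.Build R R
  (hausdorff_premeasure s d) (hausdorff_premeasure0 s d)
  (hausdorff_premeasure_ge0 s d) (@le_hausdorff_premeasure s d)
  (@hausdorff_premeasure_sigma_subadditive s d).

Lemma hausdorff_premeasure_le s d r U : (0 <= s)%R -> (r <= d)%R ->
  (forall x y, U x -> U y -> (`|x - y| <= r)%R) ->
  hausdorff_premeasure s d U <= (r `^ s)%:E.
Proof.
move=> s0 rd Ur; apply: le_trans (ediam_pow_le s0 Ur).
have -> : ediam_pow s U = small_ediam_pow s d U.
  by rewrite /small_ediam_pow (le_trans (ediam_le Ur)).
rewrite hausdorff_premeasureE; apply: ereal_inf_lbound.
exists (fun k => if k is 0%N then U else set0).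
  by split=> // x Ux; exists 0%N.
rewrite nneseries_recl//; last by move=> k _; exact: small_ediam_pow_ge0.
by rewrite eseries0 ?adde0// => -[|k]// _ _; rewrite small_ediam_pow0.
Qed.

(** * Sets of Hausdorff measure zero *)

(** Nullity can be checked one mesh at a time, at each of which countable
    subadditivity is available. *)
Lemma hausdorff_measure_eq0P s A : hausdorff_measure s A = 0 <->
  forall d, (0 < d)%R -> hausdorff_premeasure s d A = 0.
Proof.
split=> [H0 d d0|H0].
  apply/eqP; rewrite eq_le hausdorff_premeasure_ge0 andbT -H0.
  by apply: ereal_sup_ubound; exists d.
apply/eqP; rewrite eq_le; apply/andP; split.
  by apply: ge_ereal_sup => _ [d /= d0 <-]; rewrite H0.
by apply: ereal_sup_ubound; exists 1%R => //=; rewrite H0.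
Qed.

Lemma hausdorff_measure_bigcup_eq0 (I : countType) s A (F : I -> set R) :
  (forall i, hausdorff_measure s (F i) = 0) -> A `<=` \bigcup_i F i ->
  hausdorff_measure s A = 0.
Proof.
move=> F0 AF; apply/hausdorff_measure_eq0P => d d0.
apply/eqP; rewrite eq_le hausdorff_premeasure_ge0 andbT.
pose G n : set R := if unpickle n is Some i then F i else set0.
apply: (@le_trans _ _ (hausdorff_premeasure s d (\bigcup_n G n))).
  apply: le_hausdorff_premeasure => x /AF[i _ Fix].
  by exists (pickle i) => //; rewrite /G pickleK.
apply: (le_trans (hausdorff_premeasure_sigma_subadditive _ _ _)).
rewrite eseries0// => n _ _; rewrite /G; case: unpickle => [i|].
  exact: (hausdorff_measure_eq0P _ _).1.
exact: hausdorff_premeasure0.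
Qed.

(** The convergence half of the Borel-Cantelli lemma: a point lying in
    infinitely many [F n] lies in the union of the [F n] with [N <= n], whose
    premeasure is at most a tail of a convergent series.  The bound [u] is
    independent of the mesh, but it only has to hold from some rank on, since
    [F n] is covered by small enough sets only when [n] is large. *)
Lemma hausdorff_measure_limsup_eq0 s A (F : (set R)^nat) (u : (\bar R)^nat) :
  (forall n, 0 <= u n) -> \sum_(0 <= n <oo) u n < +oo ->
  (forall d, (0 < d)%R ->
    \forall n \near \oo, hausdorff_premeasure s d (F n) <= u n) ->
  (forall x, A x -> forall N, exists2 n, (N <= n)%N & F n x) ->
  hausdorff_measure s A = 0.
Proof.
move=> u0 usum Fu AF; apply/hausdorff_measure_eq0P => d d0.
apply/eqP; rewrite eq_le hausdorff_premeasure_ge0 andbT.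
have utail := nneseries_tail_cvg usum (fun k _ => u0 k).
rewrite -(cvg_lim _ utail)//; apply: lime_ge.
  by apply/cvg_ex; exists 0.
have [N0 _ FuN] := Fu _ d0.
near=> N.
pose G n : set R := if (N <= n)%N then F n else set0.
apply: (@le_trans _ _ (hausdorff_premeasure s d (\bigcup_n G n))).
  apply: le_hausdorff_premeasure => x /AF/(_ N)[n Nn Fnx].
  by exists n => //; rewrite /G Nn.
apply: (le_trans (hausdorff_premeasure_sigma_subadditive _ _ _)).
rewrite (nneseries_split 0%N N)//; last first.
  by move=> k _; exact: hausdorff_premeasure_ge0.
rewrite add0n big1_seq ?add0e; last first.
  move=> k; rewrite mem_index_iota /= => kN.
  by rewrite /G leqNgt kN hausdorff_premeasure0.
apply: lee_lim.
- by apply: is_cvg_nneseries => k *; exact: hausdorff_premeasure_ge0.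
- by apply: is_cvg_nneseries.
apply: nearW => m; rewrite big_nat [leRHS]big_nat.
apply: lee_sum => k /andP[Nk _].
rewrite /G Nk; apply: FuN => /=; apply: leq_trans Nk.
near: N; exact: nbhs_infty_ge.
Unshelve. all: by end_near. Qed.

(** A set is contained in an interval twice as long as its diameter, centred at
    any of its points.  The value of [lebesgue_measure] at an arbitrary set is
    its outer measure, so [A] may be non-measurable. *)
Lemma hausdorff1_lebesgue_eq0 A : hausdorff_measure 1 A = 0 ->
  lebesgue_measure A = 0.
Proof.
move/hausdorff_measure_eq0P/(_ 1%R ltr01) => A0.
apply/eqP; rewrite eq_le measure_ge0 andbT.
apply/lee_addgt0Pr => e e0; rewrite add0e.
have [_ [U [AU Ud] <-] Ue] :
    exists2 x, [set \sum_(0 <= k <oo) ediam_pow 1 (U k) | U in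
    [set U : (set R)^nat |
      A `<=` \bigcup_k U k /\ forall k, ediam (U k) <= 1%:E]] x &
   x < (e / 2)%:E.
  apply: ereal_inf_lt.
  by rewrite -/(hausdorff_premeasure 1 1 A) A0 lte_fin divr_gt0.
apply: (@le_trans _ _ (\sum_(0 <= k <oo) 2%:E * ediam_pow 1 (U k))); last first.
  rewrite nneseriesZl; last by move=> k _; exact: ediam_pow_ge0.
  have -> : e%:E = 2%:E * (e / 2)%:E by rewrite -EFinM mulrC divfK.
  by rewrite lee_pmul2l// ltW.
apply: (@le_trans _ _ (\sum_(0 <= k <oo) lebesgue_measure (U k))).
  apply: (@le_trans _ _ (lebesgue_measure (\bigcup_k U k))).
    exact: le_mu_ext.
  by apply: mu_ext_sigma_subadditive.
apply: lee_nneseries => // k _.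
rewrite /ediam_pow; case: ifPn => [/eqP ->|/set0P U0].
  by rewrite measure0 mule0.
have diam_ge0 := ediam_ge0 U0; rewrite poweRe1//.
have diam_fin : ediam (U k) \is a fin_num.
  by rewrite ge0_fin_numE// (le_lt_trans (Ud k))// ltry.
have [x Ux] := U0.
rewrite -(fineK diam_fin) -EFinM; set r := fine _.
have r0 : (0 <= r)%R by exact: fine_ge0.
apply: (@le_trans _ _ (lebesgue_measure `[(x - r)%R, (x + r)%R]%classic)).
  apply: le_mu_ext => y Uy /=; rewrite in_itv/= -ler_distl.
  rewrite -lee_fin fineK// ; apply: ereal_sup_ubound; exists (y, x) => //=.
rewrite lebesgue_measure_itv/= lte_fin; case: ifPn => _; last first.
  by rewrite lee_fin mulr_ge0.
by rewrite -EFinB lee_fin; lra.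
Qed.

End hausdorff_null.

(** * Powers close to integers *)

(** Shifts a symmetric window of integers to an initial segment of the natural
    numbers, which can index a finite union. *)
Lemma int_window (m : int) (M : nat) : (`|m| <= M)%N ->
  exists2 i, (i < M.*2.+1)%N & (i%:Z - M%:Z = m)%R.
Proof. by move=> mM; exists `|(m + M%:Z)%R|%N; lia. Qed.

Section close_powers.
Context {R : realType}.
Local Open Scope ring_scope.
Implicit Types (a b c s x y z alpha : R).

Lemma dist_int_lt x e : dist_int x < e -> exists m : int, `|x - m%:~R| < e.
Proof.
move=> /inf_lt[|_ [m _ <-] xm]; last by exists m.
by exists `|x - 0%:~R|, 0.
Qed.

Lemma dist_int_ge0 x : 0 <= dist_int x.
Proof.
by apply: lb_le_inf; [exists `|x - 0%:~R|, 0 | move=> _ [m _ <-]].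
Qed.

(** In the factorization of [x ^+ n.+1 - y ^+ n.+1] by [x - y], the cofactor is
    a sum of nonnegative terms, one of which is [x ^+ n]. *)
Lemma ler_dist_exprS a x y n : 0 <= a -> a <= x -> a <= y ->
  a ^+ n * `|x - y| <= `|x ^+ n.+1 - y ^+ n.+1|.
Proof.
move=> a0 ax ay; have x0 := le_trans a0 ax; have y0 := le_trans a0 ay.
rewrite subrXX normrM mulrC ler_wpM2l// big_ord_recl/= subn0 expr0 mulr1.
rewrite ger0_norm; last first.
  rewrite addr_ge0 ?exprn_ge0// sumr_ge0// => i _.
  by rewrite mulr_ge0 ?exprn_ge0.
rewrite (le_trans (lerXn2r n _ _ ax)) ?nnegrE// lerDl sumr_ge0// => i _.
by rewrite mulr_ge0 ?exprn_ge0.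
Qed.

Definition close_powers alpha a b c n : set R :=
  [set z | a <= z <= b /\ dist_int (alpha * z ^+ n.+1) < c ^+ n.+1].

(** The derivative of [alpha * x ^+ n.+1] is at least of order
    [`|alpha| * a ^+ n] on [x >= a], so the points whose image lies within
    [c ^+ n.+1] of one integer [m] are within [O((c / a) ^+ n)] of each
    other. *)
Lemma close_powers_diam alpha a c n (m : int) x y :
  alpha != 0 -> 0 < a -> a <= x -> a <= y ->
  `|alpha * x ^+ n.+1 - m%:~R| < c ^+ n.+1 ->
  `|alpha * y ^+ n.+1 - m%:~R| < c ^+ n.+1 ->
  `|x - y| <= 2 * c / `|alpha| * (c / a) ^+ n.
Proof.
move=> alpha0 a0 ax ay xm ym.
have an0 : 0 < `|alpha| * a ^+ n by rewrite mulr_gt0 ?normr_gt0 ?exprn_gt0.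
have -> : 2 * c / `|alpha| * (c / a) ^+ n = 2 * c ^+ n.+1 / (`|alpha| * a ^+ n).
  by rewrite expr_div_n exprS; field;
    rewrite normr_eq0 alpha0 expf_neq0 ?gt_eqF.
rewrite ler_pdivlMr// mulrCA.
apply: (@le_trans _ _ (`|alpha| * `|x ^+ n.+1 - y ^+ n.+1|)).
  by rewrite ler_wpM2l// mulrC ler_dist_exprS// ltW.
rewrite -normrM mulrBr (le_trans (ler_distD m%:~R _ _))// [leRHS]mulrDl mul1r.
by rewrite lerD// ltW// distrC.
Qed.

(** On the window [[a, b]] only [O(b ^+ n)] integers [m] can be approached, and
    each contributes a set of diameter [O((c / a) ^+ n)].  Hence the geometric
    ratio [b * (c / a) `^ s]. *)
Lemma close_powers_premeasure alpha a b c s d n :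
  alpha != 0 -> 0 < a -> 1 <= b -> 0 < c <= 1 -> 0 <= s ->
  2 * c / `|alpha| * (c / a) ^+ n <= d ->
  (hausdorff_premeasure s d (close_powers alpha a b c n) <=
   ((2 * `|alpha| + 3) * b * (2 * c / `|alpha|) `^ s *
     (b * (c / a) `^ s) ^+ n)%:E)%E.
Proof.
move=> alpha0 a0 b1 /andP[c0 c1] s0; set r := _ * _ ^+ n => rd.
have b0 : 0 < b by lra.
have bn1 : 1 <= b ^+ n.+1 by rewrite exprn_ege1.
have alpha_gt0 : 0 < `|alpha| by rewrite normr_gt0.
(* Any integer within 1 of [alpha * z ^+ n.+1] with [0 <= z <= b] has
   absolute value at most [M]. *)
pose M := Num.truncn ((`|alpha| + 1) * b ^+ n.+1).
pose I (i : nat) : set R := [set z | a <= z /\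
  `|alpha * z ^+ n.+1 - (i%:Z - M%:Z)%:~R| < c ^+ n.+1].
have sub : close_powers alpha a b c n `<=` \big[setU/set0]_(i < M.*2.+1) I i.
  move=> z [/andP[az zb] /dist_int_lt[m zm]].
  have mM : (`|m|%N <= M)%N.
    rewrite truncn_ge_nat; last first.
      by rewrite mulr_ge0// ?addr_ge0// ltW ?exprn_gt0.
    rewrite natr_absz intr_norm.
    have -> : m%:~R = alpha * z ^+ n.+1 - (alpha * z ^+ n.+1 - m%:~R) :> R.
      by ring.
    rewrite (le_trans (ler_normB _ _))// mulrDl mul1r lerD//.
      rewrite normrM ler_wpM2l// ger0_norm ?exprn_ge0//; last first.
        by rewrite (le_trans (ltW a0)).
      by apply: lerXn2r => //; rewrite nnegrE ltW// (lt_le_trans a0).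
    by rewrite (le_trans (ltW zm))// (le_trans _ bn1)// exprn_ile1// ltW.
  have [i iM im] := int_window mM.
  by rewrite -bigcup_mkord; exists i => //; split; rewrite // im.
apply: (le_trans (le_hausdorff_premeasure s d sub)).
apply: (le_trans (outer_measure_subadditive _ _ _)).
apply: (@le_trans _ _ (\sum_(i < M.*2.+1) (r `^ s)%:E)%E).
  apply: lee_sum => i _.
  apply: hausdorff_premeasure_le => // x y [ax xm] [ay ym].
  exact: (close_powers_diam alpha0 a0 ax ay xm ym).
rewrite sumEFin lee_fin sumr_const card_ord -[leLHS]mulr_natl.
have -> : r `^ s = (2 * c / `|alpha|) `^ s * ((c / a) `^ s) ^+ n.
  have ca0 : 0 <= c / a by rewrite divr_ge0// ltW.
  have k0 : 0 <= 2 * c / `|alpha| by rewrite divr_ge0// mulr_ge0// ltW.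
  rewrite /r powRM ?exprn_ge0//; congr (_ * _).
  by rewrite -powR_mulrn// powRAC powR_mulrn// powR_ge0.
have := powR_ge0 (2 * c / `|alpha|) s; have := powR_ge0 (c / a) s.
set p := (2 * c / _) `^ s; set q := (c / a) `^ s; move: p q => p q q0 p0.
rewrite exprMn.
have -> : (2 * `|alpha| + 3) * b * p * (b ^+ n * q ^+ n) =
  (2 * `|alpha| + 3) * b ^+ n.+1 * (p * q ^+ n) by rewrite exprS; ring.
rewrite ler_wpM2r ?mulr_ge0 ?exprn_ge0//.
have : M%:R <= (`|alpha| + 1) * b ^+ n.+1.
  by rewrite truncn_le// mulr_ge0 ?addr_ge0 ?exprn_ge0 ?ltW.
rewrite -[M.*2.+1]addn1 natrD -muln2 natrM => Mle.
rewrite [leRHS](_ : _ = (`|alpha| + 1) * b ^+ n.+1 * 2 + b ^+ n.+1); last first.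
  by ring.
by rewrite lerD// ler_wpM2r.
Qed.

End close_powers.

(** * Bases with a large approximation exponent *)

Section large_exponent.
Context {R : realType}.
Local Open Scope ring_scope.
Implicit Types (a b c s x y z alpha delta : R).

Lemma limn_esup_gt (u : (\bar R)^nat) (l : \bar R) : (l < limn_esup u)%E ->
  forall N, exists2 n, (N <= n)%N & (l < u n)%E.
Proof.
move=> lu N.
have : (l < ereal_sup (u @` [set n | (N <= n)%N]))%E.
  apply: (lt_le_trans lu); apply: ereal_inf_lbound.
  by exists [set n | (N <= n)%N] => //; exists N.
by move=> /ereal_sup_gt[_ [n Nn <-] lun]; exists n.
Qed.

Definition close_powers_io alpha a b c : set R :=
  [set z | forall N, exists2 n, (N <= n)%N & close_powers alpha a b c n z].

(** The window [[a, b]] and the rate [c] for which the counting estimate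
    produces a convergent geometric series in dimension [s]. *)
Definition admissible s a b c :=
  [&& 0 < a, 1 <= b, 0 < c <= 1 & b * (c / a) `^ s < 1].

(** The geometric series of ratio [b * (c / a) `^ s] converges.  That ratio
    being less than 1 with [1 <= b] also forces [c < a], so the diameters
    of the covering sets tend to 0. *)
Lemma hausdorff_measure_close_powers_io alpha s a b c :
  alpha != 0 -> 0 < s -> admissible s a b c ->
  hausdorff_measure s (close_powers_io alpha a b c) = 0%E.
Proof.
move=> alpha0 s0 /and4P[a0 b1 /andP[c0 c1] bca].
have b0 : 0 < b by lra.
have ca0 : 0 <= c / a by rewrite divr_ge0// ltW.
have ca1 : c / a < 1.
  rewrite ltNge; apply/negP => ca1; move: bca; rewrite ltNge => /negP; apply.
  have : 1 `^ s <= (c / a) `^ s by rewrite ge0_ler_powR ?nnegrE// ltW.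
  by rewrite powR1 => ca1s; rewrite -[leLHS]mulr1 ler_pM.
pose q := b * (c / a) `^ s.
have q0 : 0 <= q by rewrite mulr_ge0 ?powR_ge0// ltW.
pose K := (2 * `|alpha| + 3) * b * (2 * c / `|alpha|) `^ s.
have K0 : 0 <= K.
  by rewrite mulr_ge0 ?powR_ge0// mulr_ge0 ?ltW// ltr_pwDr// mulr_ge0.
apply: (@hausdorff_measure_limsup_eq0 _ _ _ (close_powers alpha a b c)
  (fun n => (K * q ^+ n)%:E)) => //.
- by move=> n; rewrite lee_fin mulr_ge0// exprn_ge0.
- have qn : `|q| < 1 by rewrite ger0_norm.
  rewrite (_ : limn _ = (K * (1 - q)^-1)%:E) ?ltry//.
  apply/cvg_lim => //; under eq_fun do rewrite sumEFin.
  apply: cvg_EFin; first exact: nearW.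
  exact: cvg_geometric_series.
- move=> d d0.
  have cvg0 : 2 * c / `|alpha| * (c / a) ^+ n @[n --> \oo] --> 0.
    by apply: cvg_geometric; rewrite ger0_norm.
  near=> n; apply: close_powers_premeasure; rewrite // ?c0// ?ltW//.
  near: n; exact: (cvgr_lt _ cvg0).
Unshelve. all: by end_near. Qed.

(** Logarithmic form of admissibility, in which the condition is linear. *)
Lemma admissible_ln s a b c : 0 < a -> 1 <= b -> 0 < c <= 1 ->
  ln b + s * (ln c - ln a) < 0 -> admissible s a b c.
Proof.
move=> a0 b1 /andP[c0 c1] lnlt0; rewrite /admissible a0 b1 c0 c1/=.
have b0 : 0 < b by lra.
have ca0 : 0 < c / a by rewrite divr_gt0.
have bca0 : 0 < b * (c / a) `^ s by rewrite mulr_gt0 ?powR_gt0.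
by rewrite -ltr_ln ?posrE// ln1 lnM ?posrE ?powR_gt0// ln_powR ln_div.
Qed.

Lemma sigma_quotient_gt alpha z delta c n : 1 < z ->
  expR (- (delta * ln z)) <= c ->
  (delta%:E < sigma_quotient alpha z n.+1)%E ->
  dist_int (alpha * z ^+ n.+1) < c ^+ n.+1.
Proof.
move=> z1 zc; rewrite /sigma_quotient.
have c0 : 0 < c by rewrite (lt_le_trans _ zc)// expR_gt0.
case: eqVneq => [-> _|dist_neq0]; first by rewrite exprn_gt0.
have dist_gt0 : 0 < dist_int (alpha * z ^+ n.+1).
  by rewrite lt_def dist_neq0 dist_int_ge0.
rewrite lte_fin ltr_pdivlMr ?mulr_gt0 ?ln_gt0// => delta_lt.
apply: (@lt_le_trans _ _ (expR (- (delta * ln z)) ^+ n.+1)); last first.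
  by apply: lerXn2r => //; rewrite nnegrE ltW// expR_gt0.
rewrite -expRM_natl -ltr_ln ?posrE ?expR_gt0// expRK; lra.
Qed.

(** At [a = b = z] and [c = z `^ (- delta)] the ratio [b * (c / a) `^ s] equals
    [z `^ (1 - s * (1 + delta))], which is less than 1.  The condition is open,
    so [a], [b] and [c] can be moved to nearby rationals with [a < z < b] and
    [c] slightly larger, and rational triples are countable. *)
Lemma rational_window alpha s z delta : 1 < z -> 0 < s -> 0 < delta ->
  1 < s * (1 + delta) -> (delta%:E < sigma_sup alpha z)%E ->
  exists p : rat * rat * rat,
    admissible s (ratr p.1.1) (ratr p.1.2) (ratr p.2) /\
    close_powers_io alpha (ratr p.1.1) (ratr p.1.2) (ratr p.2) z.
Proof.
move=> z1 s0 delta0 sdelta zsigma.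
have z0 : 0 < z by lra.
have lnz0 : 0 < ln z by rewrite ln_gt0.
(* Moving ln a, ln b and ln c by eta changes the logarithm of the ratio by at
   most (1 + 2 * s) * eta, which this value makes equal to the available
   slack. *)
pose eta := ln z * (s * (1 + delta) - 1) / (1 + 2 * s).
have eta0 : 0 < eta by rewrite divr_gt0// ?mulr_gt0//; lra.
have etaE : eta * (1 + 2 * s) = ln z * (s * (1 + delta) - 1).
  by rewrite divfK// gt_eqF//; lra.
pose L := delta * ln z.
have L0 : 0 < L by rewrite mulr_gt0.
have /rat_in_itvoo[a] : expR (ln z - eta) < z :> R.
  by rewrite -[ltRHS]lnK// ltr_expR; lra.
rewrite in_itv/= => /andP[az za].
have /rat_in_itvoo[b] : z < expR (ln z + eta) :> R.
  by rewrite -[ltLHS]lnK// ltr_expR; lra.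
rewrite in_itv/= => /andP[zb bz].
(* The minimum with 0 keeps c <= 1. *)
have /rat_in_itvoo[c] : expR (- L) < expR (Num.min 0 (eta - L)) :> R.
  by rewrite ltr_expR lt_min; lra.
rewrite in_itv/= => /andP[cL Lc].
have a0 : 0 < ratr a :> R by rewrite (lt_trans _ az)// expR_gt0.
have b0 : 0 < ratr b :> R by lra.
have c0 : 0 < ratr c :> R by rewrite (lt_trans _ cL)// expR_gt0.
have lna : ln z - eta < ln (ratr a) by rewrite -ltr_expR lnK.
have lnb : ln (ratr b) < ln z + eta by rewrite -ltr_expR lnK.
have : ln (ratr c) < Num.min 0 (eta - L) by rewrite -ltr_expR lnK.
rewrite lt_min => /andP[lnc0 lnc].
exists (a, b, c); split => /=.
  apply: admissible_ln; rewrite ?c0 ?(ltW (lt_trans z1 zb))//=.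
    by rewrite -ler_ln ?posrE// ln1 ltW.
  have : s * (ln (ratr c) - ln (ratr a)) < s * (2 * eta - L - ln z).
    by rewrite ltr_pM2l//; lra.
  rewrite /L; nra.
move=> N; have [n Nn zn] := limn_esup_gt zsigma N.
exists n => //; split; first by rewrite (ltW za) (ltW zb).
by apply: (sigma_quotient_gt z1 _ zn); rewrite ltW.
Qed.

(** The exponent [delta] may depend on the point, which lets the same lemma
    treat finite thresholds and an infinite exponent. *)
Lemma hausdorff_measure_sigma_sup alpha s (A : set R) : alpha != 0 -> 0 < s ->
  (forall z, A z -> 1 < z /\ exists delta,
     [/\ 0 < delta, 1 < s * (1 + delta) & (delta%:E < sigma_sup alpha z)%E]) ->
  hausdorff_measure s A = 0%E.
Proof.
move=> alpha0 s0 Asigma.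
pose F (p : rat * rat * rat) : set R :=
  if admissible s (ratr p.1.1) (ratr p.1.2) (ratr p.2)
  then close_powers_io alpha (ratr p.1.1) (ratr p.1.2) (ratr p.2) else set0.
apply: (@hausdorff_measure_bigcup_eq0 _ _ _ _ F) => [p|z /Asigma].
  rewrite /F; case: ifPn => adm; first exact: hausdorff_measure_close_powers_io.
  by apply/hausdorff_measure_eq0P => d d0; exact: hausdorff_premeasure0.
move=> [z1 [delta [delta0 sdelta zdelta]]].
have [p [padm zp]] := rational_window z1 s0 delta0 sdelta zdelta.
by exists p; rewrite // /F padm.
Qed.

End large_exponent.

(* The case s = 0 arises only for delta = +oo; there the 0-dimensional measure
   is the counting measure and the claim fails (for alpha = 1, the integer 2
   lies in Theta +oo 1), so the measures considered have dimension s > 0. *)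
Theorem theorem3p12 (R : realType) (alpha : R) (halpha : alpha != 0%R) :
  (forall delta : \bar R, 0 <= delta ->
     (forall s : R, (0 < s)%R -> (1 + delta)^-1 <= s%:E ->
        hausdorff_measure s (Theta delta alpha) = 0) /\
     hausdorff_dim (Theta delta alpha) <= (1 + delta)^-1) /\
  lebesgue_measure
    ([set zeta | (1 < zeta)%R /\ 0 < sigma_sup alpha zeta] : set R) = 0.
Proof.
have null (delta : \bar R) (s : R) : 0 <= delta -> (0 < s)%R ->
    (1 + delta)^-1 <= s%:E -> hausdorff_measure s (Theta delta alpha) = 0.
  move=> delta0 s0 deltas; apply: (hausdorff_measure_sigma_sup halpha s0).
  move=> z [z1 zsigma]; split => //.
  case: delta delta0 deltas zsigma => [delta| |]//=.
  - rewrite lee_fin => delta0; rewrite -EFinD inver gt_eqF ?lee_fin; last lra.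
    rewrite -[leLHS]div1r ler_pdivrMr; last lra.
    move=> sdelta deltasigma.
    have [y dy ys] : exists2 y : R, (delta < y)%R & y%:E < sigma_sup alpha z.
      case: (sigma_sup alpha z) deltasigma => [x||]//.
      + rewrite lte_fin => dx; exists ((delta + x) / 2)%R; first lra.
        by rewrite lte_fin; lra.
      + by move=> _; exists (delta + 1)%R; rewrite ?ltry//; lra.
    exists y; split => //; first lra.
    by rewrite (le_lt_trans sdelta)// ltr_pM2l//; lra.
  - move=> _ _ ->; exists (s^-1)%R; rewrite invr_gt0 s0 ltry; split=> //.
    by rewrite mulrDr mulfV ?gt_eqF//; lra.
split=> [delta delta0|].
  split=> [s|]; first exact: null.
  have [t t0 tE] : exists2 t : R, (0 <= t)%R & (1 + delta)^-1 = t%:E.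
    case: delta delta0 => [x| |]//=; last by exists 0%R.
    rewrite lee_fin => x0; exists (1 + x)^-1%R; first by rewrite invr_ge0; lra.
    by rewrite -EFinD inver gt_eqF//; lra.
  apply/lee_addgt0Pr => e e0; apply: ereal_inf_lbound => /=.
  exists (t + e)%R; last by rewrite tE.
  split; first lra.
  by apply: null => //; [lra|rewrite tE lee_fin; lra].
apply: hausdorff1_lebesgue_eq0.
rewrite (_ : [set _ | _] = Theta 0 alpha).
  by apply: null; rewrite // adde0 inve1.
by apply/seteqP; split=> z [].
Qed.
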